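(* Let $R$ be a unital $*$-ring and let $p,q\in R$ be projectors. Suppose that $p-pq$ is $*$-cancellable and that $1-pq\in R^\dag$. Then $p-q\in R^\dag$ and $$(p-q)^\dag=(1-pq)^\dag (p-pq)+(p+q-pq)^\dag(pq-q).$$
   Context: A unital $*$-ring is an associative (not necessarily commutative) ring $R$ with unity $1$ and an involution $a\mapsto a^*$ satisfying $(a^* )^*=a$, $(a+b)^*=a^*+b^*$, $(ab)^*=b^*a^*$. An element $a\in R$ is MP-invertible if there is $b\in R$ with $aba=a$, $bab=b$, $(ab)^*=ab$, $(ba)^*=ba$; such $b$ is unique and denoted $a^\dag$ (the Moore-Penrose inverse). $R^\dag$ is the set of MP-invertible elements of $R$. A formula in the conclusion involving $x^\dag$ includes the assertion that $x\in R^\dag$. An element $p\in R$ is a projector if $p^2=p=p^*$. An element $a\in R$ is $*$-cancellable if, for all $x\in R$, $a^*ax=0$ implies $ax=0$, and $xaa^*=0$ implies $xa=0$. *)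

(* Defs.v *)
From HB Require Import structures.
From mathcomp Require Import all_boot all_algebra.
From mathcomp Require Import boolp classical_sets.

Set Implicit Arguments.
Unset Strict Implicit.
Unset Printing Implicit Defensive.

Import GRing.Theory.
Local Open Scope ring_scope.

(* Built on pzRingType so that the trivial ring (1 = 0) is not excluded. *)
HB.mixin Record PzRing_isStarRing R of GRing.PzRing R := {
  star : R -> R;
  starK : forall a : R, star (star a) = a;
  starD : forall a b : R, star (a + b) = star a + star b;
  starM : forall a b : R, star (a * b) = star b * star a
}.

#[short(type="starRingType")]
HB.structure Definition StarRing :=
  { R of GRing.PzRing R & PzRing_isStarRing R }.

Section MoorePenrose.
Variable R : starRingType.
Implicit Types a b p : R.

Definition is_MP_inverse a b : Prop :=
  [/\ a * b * a = a, b * a * b = b, star (a * b) = a * b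
    & star (b * a) = b * a].

Definition MP_invertible a : Prop := exists b, is_MP_inverse a b.

(* The junk value 0 is taken when a is not MP-invertible, so an equation about
   MPinv a has to be accompanied by MP_invertible a. *)
Definition MPinv a : R := xget 0 [set b | is_MP_inverse a b].

Definition projector p : Prop := p ^+ 2 = p /\ star p = p.

Definition star_cancellable a : Prop :=
  forall x : R, (star a * a * x = 0 -> a * x = 0) /\
                (x * a * star a = 0 -> x * a = 0).

Lemma is_MP_inverse_uniq a b c :
  is_MP_inverse a b -> is_MP_inverse a c -> b = c.
Proof.
move=> [aba bab abs bas] [aca cac acs cas].
have ab_ac : a * b = a * c.
  by rewrite -acs -[in RHS]aba -mulrA starM acs abs mulrA aca.
have ba_ca : b * a = c * a.
  by rewrite -cas -[in RHS]aba -mulrA mulrA starM bas cas -!mulrA [a * (c * a)]mulrA aca.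
by rewrite -bab ba_ca -mulrA ab_ac mulrA cac.
Qed.

Lemma MPinvP a : MP_invertible a -> is_MP_inverse a (MPinv a).
Proof. exact: xgetPex. Qed.

Lemma MPinv_eq a b : is_MP_inverse a b -> MPinv a = b.
Proof.
by move=> ab; apply: xget_unique => // c /is_MP_inverse_uniq; apply.
Qed.

End MoorePenrose.

(* Main.v *)
(* Write x = p(1-q)p and a = p(1-q), so that x = a a^*.  The triangular
   factorisation (1 - a(1-p)) (1-pq) = (1-p) + x turns the Moore-Penrose
   invertibility of 1-pq into x in R x^2, and *-cancellability of a then gives
   a in x R; hence x has a self-adjoint group inverse y with xya = a.  The
   identity x (pq(1-p)) = (pq(1-p)) D with D = (1-p)q(1-p) transfers this
   property from the pair (p, q) to (1-p, 1-q), giving a group inverse d of D.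
   As (p-q)^2 = x + D, the inverse of p-q is (y + d)(p - q), while
   (1-pq)^dag a = y a, and the analogous identity holds for the pair
   (1-p, 1-q), where 1-(1-p)(1-q) = p+q-pq. *)
Require Import Defs.
From mathcomp Require Import all_boot all_algebra.

Local Open Scope ring_scope.

Import GRing.Theory.

Section StarRing.
Variable R : starRingType.
Implicit Types a b p q r v w x y : R.

(** * Involution and complementary projectors *)

Lemma star0 : star (0 : R) = 0.
Proof. by apply: (addrI (star 0)); rewrite -starD !addr0. Qed.

Lemma starN a : star (- a) = - star a.
Proof. by apply: (addrI (star a)); rewrite -starD !subrr star0. Qed.

Lemma starB a b : star (a - b) = star a - star b.
Proof. by rewrite starD starN. Qed.

Lemma star1 : star (1 : R) = 1.
Proof. by rewrite -[LHS]mul1r -[X in X * _]starK -starM mul1r starK. Qed.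

Lemma projector_compl p : projector p -> projector (1 - p).
Proof.
move=> [pp ps]; split; last by rewrite starB star1 ps.
by rewrite expr2 mulrBl mul1r mulrBr mulr1 -expr2 pp subrr subr0.
Qed.

Lemma projector_mul_compl p : projector p -> p * (1 - p) = 0.
Proof. by move=> [pp _]; rewrite mulrBr mulr1 -expr2 pp subrr. Qed.

Lemma projector_compl_mul p : projector p -> (1 - p) * p = 0.
Proof. by move=> [pp _]; rewrite mulrBl mul1r -expr2 pp subrr. Qed.

Lemma star_corner p q : projector p -> projector q ->
  star (p * q * p) = p * q * p.
Proof. by move=> [_ ps] [_ qs]; rewrite !starM ps qs mulrA. Qed.

(** The adjoint of [r * r * w * r = r] is [r * w * r * r = r]; together with [w] commuting with
    [r * r], this makes [w] commute with [r] itself. *)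
Lemma MP_inverse_of_square r w :
    star r = r -> star w = w -> w * (r * r) = r * r * w ->
    r * r * w * r = r -> w * (r * r) * w = w ->
  is_MP_inverse r (w * r).
Proof.
move=> rs ws wrr rrwr wrrw.
have rwrr : r * w * r * r = r.
  by have /(congr1 star) := rrwr; rewrite !starM rs ws !mulrA.
have wr_rw : w * r = r * w.
  have rE : r = r * r * r * w by rewrite -[LHS]rwrr -!mulrA wrr !mulrA.
  by rewrite {1}rE !mulrA -(mulrA w) wrr rrwr.
split.
- by rewrite mulrA.
- by rewrite !mulrA -(mulrA w) wrrw.
- by rewrite mulrA -wr_rw -mulrA starM ws starM rs wrr.
- by rewrite -mulrA starM ws starM rs wrr.
Qed.

(** * Group inverses in a corner *)

(* [y] is the group inverse of [a * p], the compression of [a] to the corner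
   [p R p]. *)
Definition corner_inverse p a y : Prop :=
  [/\ star y = y, p * y = y, y * (a * p) = a * p * y,
      y * (a * p) * y = y & a * p * y * a = a].

Lemma corner_inverse_mulr p a y :
  projector p -> corner_inverse p a y -> y * p = y.
Proof.
move=> [_ ps] [ys py _ _ _].
by have /(congr1 star) := py; rewrite starM ys ps.
Qed.

(** Put [x = a * p]. The adjoint of [v * x * x = x] yields [v * x = x * star v], so [v * x * star v]
    is a self-adjoint group inverse of [x]. The factorisation of [a] through [x] extends
    [x * y * x = x] to [x * y * a = a]. *)
Lemma corner_inverse_ex p a v s :
    p * a = a -> star (a * p) = a * p ->
    v * (a * p) * (a * p) = a * p -> a = a * p * s ->
  exists y, corner_inverse p a y.
Proof.
rewrite /corner_inverse => pa.
have : p * (a * p) = a * p by rewrite mulrA pa.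
move: (a * p) => x px xs vxx aE.
have xxv : x * x * star v = x.
  by have /(congr1 star) := vxx; rewrite !starM xs mulrA.
have vx : v * x = x * star v by rewrite -{1}xxv !mulrA vxx.
have yE : v * x * star v = x * star v * star v by rewrite vx.
have xy : x * (v * x * star v) = v * x by rewrite yE !mulrA xxv vx.
have yx : v * x * star v * x = v * x.
  by rewrite -[v * x * star v]mulrA -vx -!mulrA [v * (x * x)]mulrA vxx.
have xvx : x * v * x = x by rewrite -mulrA vx mulrA xxv.
exists (v * x * star v); split.
- by rewrite !starM starK xs mulrA.
- by rewrite yE !mulrA px.
- by rewrite xy yx.
- by rewrite yx !mulrA -[v * x * v]mulrA -[v * (x * v) * x]mulrA xvx.
- by rewrite xy aE mulrA vxx.
Qed.

(** Along [1 = p + (1 - p)] the element is block triangular, with diagonal blocks [a * p] and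
    [1 - p]; it is inverted blockwise, and both products equal the projector
    [1 - p + y * (a * p)]. *)
Lemma corner_MP_inverse p a y :
    projector p -> p * a = a -> star (a * p) = a * p -> corner_inverse p a y ->
  is_MP_inverse (1 - p + a) (1 - p + y - y * a * (1 - p)).
Proof.
move=> hp pa aps hy; have yp := corner_inverse_mulr _ _ _ hp hy.
have [ys py yap yapy apya] := hy.
have [] := projector_compl _ hp; rewrite expr2 => qq qs.
have := projector_mul_compl _ hp; have := projector_compl_mul _ hp.
have pq1 : p + (1 - p) = 1 by rewrite addrC subrK.
move: (1 - p : R) qq qs pq1 => q qq qs pq1 qp pq.
have qa : q * a = 0 by rewrite -pa mulrA qp mul0r.
have qy : q * y = 0 by rewrite -py mulrA qp mul0r.
have yq : y * q = 0 by rewrite -yp -mulrA pq mulr0.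
have apE : a - a * q = a * p by rewrite -[X in X - _]mulr1 -pq1 mulrDr addrK.
have ay : a * y = a * p * y by rewrite -{1}py mulrA.
have GM : (q + y - y * a * q) * (q + a) = q + y * (a * p).
  rewrite mulrBl !mulrDl !mulrDr qq qa yq addr0 add0r -[y * a * q * a]mulrA qa.
  by rewrite mulr0 addr0 -[y * a * q * q]mulrA qq -addrA -mulrA -mulrBr apE.
have MG : (q + a) * (q + y - y * a * q) = q + y * (a * p).
  rewrite mulrBr !mulrDl !mulrDr qq qy addr0 !mulrA qy !mul0r add0r ay apya.
  by rewrite -yap mulrA addrA addrAC addrK.
split.
- rewrite MG mulrDl !mulrDr qq qa addr0 yap apya -[_ * y * q]mulrA yq mulr0.
  by rewrite add0r.
- rewrite GM mulrBr !mulrDl !mulrDr qq qy addr0 !mulrA qy !mul0r add0r.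
  rewrite -[y * a * p * q]mulrA pq mulr0 add0r.
  by rewrite -[y * a * p]mulrA yapy.
- by rewrite MG starD qs starM aps ys yap.
- by rewrite GM starD qs starM aps ys yap.
Qed.

(** All terms of the inverse except [y] end in [1 - p], which annihilates [a]. *)
Lemma MPinv_mul_corner p a y :
    projector p -> p * a = a -> star (a * p) = a * p -> corner_inverse p a y ->
  MPinv (1 - p + a) * a = y * a.
Proof.
move=> hp pa aps hy.
rewrite (MPinv_eq (corner_MP_inverse _ _ _ hp pa aps hy)).
have qa : (1 - p : R) * a = 0 by rewrite mulrBl mul1r pa subrr.
move: (1 - p : R) qa => q qa.
have -> : (q + y - y * a * q) * a = q * a + y * a - y * a * (q * a).
  by rewrite mulrBl mulrDl !mulrA.
by rewrite qa mulr0 add0r subr0.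
Qed.

Lemma corner_inverse_of_MP p a :
    projector p -> p * a = a -> a * star a = a * p ->
    (forall z, z * a * star a = 0 -> z * a = 0) ->
    MP_invertible (1 - p + a) ->
  exists y, corner_inverse p a y.
Proof.
move=> hp pa aas canc [g [mgm _ _ gms]].
have [pp ps] := hp.
have aps : star (a * p) = a * p by rewrite -aas starM starK.
have [] := projector_compl _ hp; rewrite expr2 => qq qs.
have := projector_mul_compl _ hp; have := projector_compl_mul _ hp.
have pq1 : p + (1 - p) = 1 by rewrite addrC subrK.
(* From here on [q] stands for [1 - p]. *)
move: (1 - p : R) qq qs pq1 mgm gms => q qq qs pq1 mgm gms qp pq.
have qa : q * a = 0 by rewrite -pa mulrA qp mul0r.
have apE : a * p + a * q = a by rewrite -mulrDr pq1 mulr1.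
set x := a * p in aas aps apE *.
have qx : q * x = 0 by rewrite mulrA qa mul0r.
have xp : x * p = x by rewrite -mulrA -expr2 pp.
have xE : x = a * p by [].
clearbody x.
have factM : (1 + a * q) * (q + x) = q + a.
  by rewrite mulrDl mul1r mulrDr -!mulrA qq qx mulr0 addr0 -addrA apE.
have Mstar : star (q + a) * (1 - star (a * q)) = q + x.
  rewrite -[1]star1 -starB -starM mulrBl mul1r mulrDr -!mulrA qq qa mulr0 addr0.
  by rewrite -[X in q + X - _]apE addrA addrK starD qs aps.
have gMM : g * (q + a) * star (q + a) = star (q + a).
  by rewrite -gms -starM mulrA mgm.
(* By [factM], [v * (q + x)] is the projector [g * (q + a)]. It fixes [star (q + a)], hence also
   [q + x] by [Mstar]. *)
pose v := g * (1 + a * q).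
have vTT : v * (q + x) * (q + x) = q + x.
  by rewrite /v -[g * _ * _]mulrA factM -Mstar mulrA gMM.
have Tp : (q + x) * p = x by rewrite mulrDl qp add0r xp.
have Tx : (q + x) * x = x * x by rewrite mulrDl qx add0r.
have vxx : v * x * x = x by rewrite -[RHS]Tp -vTT -!mulrA Tp Tx.
have xxv : x * x * star v = x.
  by have /(congr1 star) := vxx; rewrite !starM aps mulrA.
have vx : v * x = x * star v by rewrite -{1}xxv !mulrA vxx.
have xvx : x * v * x = x by rewrite -mulrA vx mulrA xxv.
apply: (corner_inverse_ex _ _ v (v * a)); rewrite -?xE //.
(* Cancellability applied to [x * v - 1], which annihilates [a * star a = x], gives
   [a = x * (v * a)]. *)
apply/esym/eqP; rewrite mulrA -subr_eq0 -[X in _ - X]mul1r -mulrBl.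
by apply/eqP/canc; rewrite -mulrA aas mulrBl mul1r xvx subrr.
Qed.

(* Off-diagonally, [p (1-q) p * B = B * D] for [B = p q (1-p)] and
   [D = (1-p) q (1-p)], which moves the group inverse from one corner to the
   other. *)
Lemma corner_inverse_compl p q y :
    projector p -> projector q -> corner_inverse p (p * (1 - q)) y ->
  exists d, corner_inverse (1 - p) ((1 - p) * q) d.
Proof.
move=> hp hq [ys py yx yxy xya].
have [pp ps] := hp; have [qq qs] := hq.
have [pp' ps'] := projector_compl _ hp.
have pp'0 := projector_mul_compl _ hp.
have p'p0 := projector_compl_mul _ hp.
have pq1 : p + (1 - p) = 1 by rewrite addrC subrK.
have qq'0 : (1 - q) * q = 0 := projector_compl_mul _ hq.
move: pp pp' qq; rewrite !expr2 => pp pp' qq.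
move: (1 - p : R) ps' pp' pp'0 p'p0 pq1 => p' ps' pp' pp'0 p'p0 pq1.
have pqp' : p * (1 - q) * p' = - (p * q * p').
  by rewrite mulrBr mulr1 mulrBl pp'0 sub0r.
(* Between the orthogonal factors [1 - q] and [q], [p] may be traded for [- p']; this is what drives
   [xB]. *)
have q'pq : (1 - q) * p * q = - ((1 - q) * p' * q).
  by apply/eqP; rewrite -addr_eq0 -mulrDl -mulrDr pq1 mulr1 qq'0.
move: (1 - q : R) qq'0 pqp' q'pq yx yxy xya => q' qq'0 pqp' q'pq yx yxy xya.
pose x := p * q' * p; pose B := p * q * p'; pose D := p' * q * p'.
have xB : x * B = B * D.
  have -> : x * B = p * (q' * (p * p) * q) * p' by rewrite /x /B !mulrA.
  have -> : B * D = p * q * (p' * p') * q * p' by rewrite /B /D !mulrA.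
  by rewrite pp pp' -[p * q * p']opprK -pqp' q'pq !(mulrN, mulNr) !mulrA.
have yxB : y * x * B = B.
  by rewrite yx /B -[p * q * p']opprK -pqp' mulrN mulrA xya.
have BE : B = y * B * D by rewrite -mulrA -xB mulrA yxB.
have Bs : star B = p' * q * p by rewrite !starM ps qs ps' mulrA.
have Ds : star D = D by rewrite !starM qs ps' mulrA.
have BsE : star B = D * (star B * y).
  by rewrite {1}BE starM Ds starM ys.
have Dsplit : D = D * D + star B * B.
  have -> : D * D = p' * q * (p' * p') * q * p' by rewrite /D !mulrA.
  have -> : star B * B = p' * q * (p * p) * q * p' by rewrite Bs /B !mulrA.
  by rewrite pp pp' -!mulrDl -mulrDr addrC pq1 mulr1 -[p' * q * q]mulrA qq.
have BsB : star B * B = star B * y * y * B * D * D.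
  have BE2 : B = y * y * B * D * D by rewrite {1}BE {1}BE -!mulrA.
  by rewrite {2}BE2 !mulrA.
have p'qp' : p' * (p' * q) = p' * q by rewrite mulrA pp'.
(* The first witness absorbs [star B * B] from [D = D * D + star B * B]; the second comes from
   [p' * q = D + star B] and [star B = D * (star B * y)]. *)
apply: (corner_inverse_ex _ _ (1 + star B * y * y * B) (1 + star B * y)) => //.
- rewrite mulrDl mul1r mulrDl -BsB; exact/esym.
- by rewrite mulrDr mulr1 -/D -BsE Bs -mulrDr addrC pq1 mulr1.
Qed.

(** * The difference of two projectors *)

Lemma sub_projectors p q : p - q = p * (1 - q) - (1 - p) * q.
Proof. by rewrite mulrBr mulr1 mulrBl mul1r opprB addrA subrK. Qed.

Lemma MP_inverse_sub_projectors p q y d :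
    projector p -> projector q -> corner_inverse p (p * (1 - q)) y ->
    corner_inverse (1 - p) ((1 - p) * q) d ->
  is_MP_inverse (p - q) ((y + d) * (p - q)).
Proof.
move=> hp hq hy hd.
have rs : star (p - q) = p - q by rewrite starB (proj2 hp) (proj2 hq).
have hp' := projector_compl _ hp; have hq' := projector_compl _ hq.
have yp := corner_inverse_mulr _ _ _ hp hy.
have dp' := corner_inverse_mulr _ _ _ hp' hd.
have := projector_compl_mul _ hp; have := projector_mul_compl _ hp.
have := projector_compl_mul _ hq; have := projector_mul_compl _ hq.
have [ys py yx yxy xya] := hy; have [ds p'd dD dDd Ddc] := hd.
move: hp hq hp' hq' rs => [pp ps] [qq qs] [pp' ps'] [qq' qs'].
move: pp qq pp' qq'; rewrite !expr2 sub_projectors.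
move: (1 - p : R) (1 - q : R) ps' qs' dp' yx yxy xya p'd dD dDd Ddc.
move=> p' q' ps' qs' dp' yx yxy xya p'd dD dDd Ddc.
move=> pp qq pp' qq' rs qq'0 q'q0 pp'0 p'p0.
have aa : p * q' * star (p * q') = p * q' * p.
  by rewrite starM ps qs' mulrA -[p * q' * q']mulrA qq'.
have cc : p' * q * star (p' * q) = p' * q * p'.
  by rewrite starM ps' qs mulrA -[p' * q * q]mulrA qq.
have ac : p * q' * star (p' * q) = 0.
  by rewrite starM ps' qs mulrA -[p * q' * q]mulrA q'q0 mulr0 mul0r.
have ca : p' * q * star (p * q') = 0.
  by rewrite starM ps qs' mulrA -[p' * q * q']mulrA qq'0 mulr0 mul0r.
have pa : p * (p * q') = p * q' by rewrite mulrA pp.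
have p'c : p' * (p' * q) = p' * q by rewrite mulrA pp'.
move: (p * q') (p' * q) rs aa cc ac ca pa p'c yx yxy xya dD dDd Ddc.
move=> a c rs aa cc ac ca pa p'c yx yxy xya dD dDd Ddc.
have yc0 : y * c = 0.
  by rewrite -p'c mulrA -yp -[y * p * p']mulrA pp'0 mulr0 mul0r.
have da0 : d * a = 0.
  by rewrite -pa mulrA -dp' -[d * p' * p]mulrA p'p0 mulr0 mul0r.
have ad0 : a * p * d = 0.
  by rewrite -p'd mulrA -[a * p * p']mulrA pp'0 mulr0 mul0r.
have cy0 : c * p' * y = 0.
  by rewrite -py mulrA -[c * p' * p]mulrA p'p0 mulr0 mul0r.
(* As [a - c] is self-adjoint, its square is [(a - c) * star (a - c)], whose cross terms vanish. *)
have rr : (a - c) * (a - c) = a * p + c * p'.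
  have -> : (a - c) * (a - c) = (a - c) * star (a - c) by rewrite rs.
  by rewrite starB mulrBr !mulrBl aa cc ac ca subr0 sub0r opprK.
have wrr : (y + d) * (a * p + c * p') = y * (a * p) + d * (c * p').
  rewrite mulrDl !mulrDr [y * (c * p')]mulrA yc0 [d * (a * p)]mulrA da0.
  by rewrite !mul0r addr0 add0r.
have rrw : (a * p + c * p') * (y + d) = a * p * y + c * p' * d.
  by rewrite mulrDl !mulrDr ad0 cy0 addr0 add0r.
apply: MP_inverse_of_square; rewrite ?rr //.
- by rewrite starD ys ds.
- by rewrite wrr rrw yx dD.
- rewrite rrw mulrBr !mulrDl xya Ddc.
  have -> : a * p * y * c = 0 by rewrite -mulrA yc0 mulr0.
  have -> : c * p' * d * a = 0 by rewrite -mulrA da0 mulr0.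
  by rewrite addr0 add0r.
- rewrite wrr mulrDl !mulrDr yxy dDd.
  have -> : y * (a * p) * d = 0 by rewrite -mulrA ad0 mulr0.
  have -> : d * (c * p') * y = 0 by rewrite -mulrA cy0 mulr0.
  by rewrite addr0 add0r.
Qed.

End StarRing.

Theorem corollary3p10 (R : starRingType) (p q : R)
  (hp : projector p) (hq : projector q)
  (hcanc : star_cancellable (p - p * q))
  (hMP : MP_invertible (1 - p * q)) :
  [/\ MP_invertible (p - q),
      MP_invertible (p + q - p * q)
    & MPinv (p - q) =
        MPinv (1 - p * q) * (p - p * q) + MPinv (p + q - p * q) * (p * q - q)].
Proof.
have hp' := projector_compl _ _ hp; have hq' := projector_compl _ _ hq.
have pa : p * (p * (1 - q)) = p * (1 - q).
  by have [pp _] := hp; rewrite mulrA -expr2 pp.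
have p'c : (1 - p) * ((1 - p) * q) = (1 - p) * q.
  by have [pp' _] := hp'; rewrite mulrA -expr2 pp'.
have aas : p * (1 - q) * star (p * (1 - q)) = p * (1 - q) * p.
  rewrite starM (proj2 hp) (proj2 hq') !mulrA -[p * _ * _]mulrA -expr2.
  by rewrite (proj1 hq').
have aps := star_corner _ _ _ hp hq'; have cps := star_corner _ _ _ hp' hq.
have aE : p - p * q = p * (1 - q) by rewrite mulrBr mulr1.
have cE : p * q - q = - ((1 - p) * q) by rewrite mulrBl mul1r opprB.
(* Both elements take the block triangular form, for [p] and for [1 - p] respectively. *)
have ME : 1 - p * q = 1 - p + p * (1 - q).
  by rewrite mulrBr mulr1 addrA subrK.
have NE : p + q - p * q = 1 - (1 - p) + (1 - p) * q.
  by rewrite subKr mulrBl mul1r addrA.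
rewrite aE in hcanc; rewrite ME in hMP.
have [y hy] :=
  corner_inverse_of_MP _ _ _ hp pa aas (fun z => proj2 (hcanc z)) hMP.
have [d hd] := corner_inverse_compl _ _ _ _ hp hq hy.
have hr := MP_inverse_sub_projectors _ _ _ _ _ hp hq hy hd.
have hN := corner_MP_inverse _ _ _ _ hp' p'c cps hd.
split.
- by exists ((y + d) * (p - q)).
- by rewrite NE; eexists; exact: hN.
rewrite (MPinv_eq hr) aE cE ME NE mulrN.
rewrite (MPinv_mul_corner _ _ _ _ hp pa aps hy).
rewrite (MPinv_mul_corner _ _ _ _ hp' p'c cps hd).
have yp := corner_inverse_mulr _ _ _ _ hp hy.
have dp' := corner_inverse_mulr _ _ _ _ hp' hd.
have yc : y * ((1 - p) * q) = 0.
  by rewrite -yp mulrA -[y * p * _]mulrA projector_mul_compl // mulr0 mul0r.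
have da : d * (p * (1 - q)) = 0.
  by rewrite -dp' mulrA -[d * _ * p]mulrA projector_compl_mul // mulr0 mul0r.
(* With [y * c = d * a = 0], [(y + d) * (a - c)] collapses to [y * a - d * c]. *)
rewrite sub_projectors; move: (p * (1 - q)) ((1 - p) * q) yc da => a c yc da.
by rewrite mulrBr !mulrDl yc da addr0 add0r.
Qed.
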